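(* Let $R$ be a real closed field and $C=R[i]$ with $i^2=-1$. For each polynomial $F=Z^n+c_1Z^{n-1}+\dots+c_n$ in $C[Z]$ define its Cauchy radius $\rho_F:=1+\max\{|c_1|,\dots,|c_n|\}$. Then $w(F|\partial\Gamma)=n$ for every rectangle $\Gamma\subset C$ containing the Cauchy disk $B(\rho_F)=\{z\in C : |z|<\rho_F\}$.
   Context: Real closed: an ordered field $R$ is real closed if whenever $P\in R[X]$ and $a<b$ in $R$ satisfy $P(a)P(b)<0$, there is $x\in R$ with $a<x<b$ and $P(x)=0$. $C=R[i]$ is identified with $R^2$ via $(x,y)\mapsto x+iy$, and $|x+iy|=\sqrt{x^2+y^2}\in R$ (square roots of nonnegative elements exist in a real closed field). For $n=0$ the maximum over the empty set is read as $0$. For $P\in C[X]$, $\operatorname{re}P,\operatorname{im}P\in R[X]$ are the polynomials with $P=\operatorname{re}P+i\operatorname{im}P$. Cauchy index: let $f\in R(X)$, $f\ne0$, $a\in R$, and write $f=(X-a)^m g$ with $m\in\mathbb{Z}$ and $g$ having neither zero nor pole at $a$. If $m\ge0$ put $\operatorname{Ind}_a^{+}(f)=\operatorname{Ind}_a^{-}(f)=0$. If $m<0$ put $\operatorname{Ind}_a^{+}(f)=\frac12\operatorname{sign}g(a)$ and $\operatorname{Ind}_a^{-}(f)=\frac12(-1)^m\operatorname{sign}g(a)$. Let $\operatorname{Ind}_x(f)=\operatorname{Ind}_x^+(f)-\operatorname{Ind}_x^-(f)$. For $a<b$, $\operatorname{Ind}_a^b(f)=\operatorname{Ind}_a^+(f)+\sum_{a<x<b}\operatorname{Ind}_x(f)-\operatorname{Ind}_b^-(f)$.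 By convention $\operatorname{Ind}_a^b(\frac{U}{V})=0$ if $U=0$ or $V=0$. Winding number: a piecewise polynomial path $\gamma\colon[0,1]\to C$ is given by polynomials $P_k\in C[X]$ on the intervals $[t_{k-1},t_k]$ of a subdivision $0=t_0<\dots<t_n=1$ (with $P_k(t_k)=P_{k+1}(t_k)$), and $w(\gamma)=\frac12\sum_k\operatorname{Ind}_{t_{k-1}}^{t_k}\bigl(\frac{\operatorname{re}P_k}{\operatorname{im}P_k}\bigr)$, which is independent of the subdivision. Rectangle: $\Gamma=[x_0,x_1]\times[y_0,y_1]$ with $x_0<x_1$, $y_0<y_1$ in $R$. $w(F|\partial\Gamma):=w(F\circ\gamma)$ where $\gamma$ interpolates linearly between $\gamma(0)=(x_0,y_0)$, $\gamma(\frac14)=(x_1,y_0)$, $\gamma(\frac12)=(x_1,y_1)$, $\gamma(\frac34)=(x_0,y_1)$, $\gamma(1)=(x_0,y_0)$. *)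

(* Defs.v *)
From HB Require Import structures.
From mathcomp Require Import all_boot all_order all_algebra.
From mathcomp Require Import complex polyorder polyrcf.
Set Implicit Arguments.
Unset Strict Implicit.
Unset Printing Implicit Defensive.
Import Order.TTheory GRing.Theory Num.Theory.
Local Open Scope ring_scope.
Local Open Scope complex_scope.

Notation "p %:F" := (@FracField.tofrac _ p) : ring_scope.

Section CauchyIndex.
Variable R : rcfType.
Implicit Types (a b x : R) (p U V : {poly R}) (f : {fraction {poly R}}).

Definition numer f : {poly R} := \n_(repr f).
Definition denom f : {poly R} := \d_(repr f).

Definition cofactor_at a p : {poly R} := p %/ ('X - a%:P) ^+ (\mu_a p).

(* If f = (X - a)^m g with g having neither zero nor pole at a, then
   frac_order a f = m and frac_lead a f = g(a); see frac_orderP and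
   frac_order_unique below. *)
Definition frac_order a f : int :=
  (\mu_a (numer f))%:Z - (\mu_a (denom f))%:Z.

Definition frac_lead a f : R :=
  (cofactor_at a (numer f)).[a] / (cofactor_at a (denom f)).[a].

Definition ind_right a f : rat :=
  if (f != 0) && (frac_order a f < 0)
  then (sgz (frac_lead a f))%:~R / 2%:R else 0.

Definition ind_left a f : rat :=
  if (f != 0) && (frac_order a f < 0)
  then (-1) ^ frac_order a f * (sgz (frac_lead a f))%:~R / 2%:R else 0.

Definition ind_at x f : rat := ind_right x f - ind_left x f.

(* ind_at x f vanishes unless x is a root of denom f (ind_at_eq0), so the sum
   over all x in ]a, b[ is the sum over the roots of denom f in ]a, b[. *)
Definition cauchy_index a b f : rat :=
  ind_right a f + \sum_(x <- roots (denom f) a b) ind_at x f - ind_left b f.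

Lemma denom_neq0 f : denom f != 0.
Proof. exact: denom_ratioP. Qed.

Lemma frac_numden f : f = (numer f)%:F / (denom f)%:F.
Proof.
rewrite /numer /denom -[LHS]reprK; case: (repr f) => -[n d] /= d0.
have dF : (d%:F : {fraction {poly R}}) != 0 by rewrite tofrac_eq0.
apply: (mulIf dF); rewrite mulfVK //.
unlock FracField.tofrac; rewrite piE; apply/eqmodP.
by rewrite /= FracField.equivfE /FracField.mulf !numden_Ratio /= ?mulr1 ?oner_eq0
  ?mulf_neq0 ?oner_eq0 // mulrC.
Qed.

Lemma frac_eq U V U' V' : V != 0 -> V' != 0 ->
  (U%:F / V%:F = U'%:F / V'%:F :> {fraction {poly R}}) <-> U * V' = U' * V.
Proof.
move=> V0 V'0; have F0 W : W != 0 -> (W%:F : {fraction {poly R}}) != 0.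
  by rewrite tofrac_eq0.
split=> [/eqP|e].
  by rewrite eqr_div ?F0 // -!tofracM tofrac_eq => /eqP.
by apply/eqP; rewrite eqr_div ?F0 // -!tofracM tofrac_eq e.
Qed.

Lemma numer_neq0 f : f != 0 -> numer f != 0.
Proof.
by apply: contraNneq => n0; rewrite [f]frac_numden n0 tofrac0 mul0r.
Qed.

Lemma XsubCF_neq0 a : (('X - a%:P)%:F : {fraction {poly R}}) != 0.
Proof. by rewrite tofrac_eq0 polyXsubC_eq0. Qed.

Lemma cofactor_atP a p : p != 0 ->
  p = cofactor_at a p * ('X - a%:P) ^+ (\mu_a p) /\ (cofactor_at a p).[a] != 0.
Proof.
move=> p0; have [q qa pE] := mu_spec a p0.
have -> : cofactor_at a p = q.
  rewrite /cofactor_at; set m := \mu_a p in pE *.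
  by rewrite pE mulpK // expf_neq0 // polyXsubC_eq0.
by split.
Qed.

Lemma frac_orderP a f : f != 0 ->
  let U := cofactor_at a (numer f) in
  let V := cofactor_at a (denom f) in
  [/\ f = ('X - a%:P)%:F ^ frac_order a f * (U%:F / V%:F),
      U.[a] != 0, V.[a] != 0 & frac_lead a f = U.[a] / V.[a]].
Proof.
move=> f0 U V.
have [nE Ua] := cofactor_atP a (numer_neq0 f0).
have [dE Va] := cofactor_atP a (denom_neq0 f).
split=> //.
rewrite {1}[f]frac_numden {1}nE {1}dE -/U -/V !tofracM !tofracXn.
rewrite /frac_order expfzDr ?XsubCF_neq0 // -exprnN.
by rewrite -exprnP invfM mulrACA mulrC.
Qed.

Lemma frac_order_unique a f (m : int) U V : U.[a] != 0 -> V.[a] != 0 ->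
  f = ('X - a%:P)%:F ^ m * (U%:F / V%:F) ->
  frac_order a f = m /\ frac_lead a f = U.[a] / V.[a].
Proof.
move=> Ua Va fE.
have nz W : W.[a] != 0 -> W != 0.
  by apply: contraNneq => ->; rewrite horner0.
have U0 := nz _ Ua; have V0 := nz _ Va.
have X0 k : ('X - a%:P : {poly R}) ^+ k != 0.
  by rewrite expf_neq0 // polyXsubC_eq0.
have f0 : f != 0.
  by rewrite fE !mulf_neq0 ?invr_eq0 ?tofrac_eq0 // expfz_neq0 // XsubCF_neq0.
case: (frac_orderP a f0); set U' := cofactor_at _ _; set V' := cofactor_at _ _.
move=> fE' U'a V'a ->; have U'0 := nz _ U'a; have V'0 := nz _ V'a.
have [i [j mE]] : exists i j : nat, m = i%:Z - j%:Z.
  by case: m {fE} => k; [exists k, 0%N; rewrite subr0 | exists 0%N, k.+1; rewrite sub0r NegzE].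
have [k [l oE]] : exists k l : nat, frac_order a f = k%:Z - l%:Z by do 2!eexists.
have E : U * ('X - a%:P) ^+ i * (V' * ('X - a%:P) ^+ l)
       = U' * ('X - a%:P) ^+ k * (V * ('X - a%:P) ^+ j).
  apply/(frac_eq _ _); rewrite ?mulf_neq0 //.
  have H W W' r s : (W * ('X - a%:P) ^+ r)%:F / (W' * ('X - a%:P) ^+ s)%:F
     = ('X - a%:P)%:F ^ (r%:Z - s%:Z) * (W%:F / W'%:F) :> {fraction {poly R}}.
    rewrite expfzDr ?XsubCF_neq0 // -exprnN -exprnP !tofracM !tofracXn.
    by rewrite invfM mulrACA mulrC.
  by rewrite !H -mE -oE -fE -fE'.
have M W r W' s : W.[a] != 0 -> W'.[a] != 0 ->
    W * ('X - a%:P) ^+ r * (W' * ('X - a%:P) ^+ s)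
    = (W * W') * ('X - a%:P) ^+ (r + s).
  by move=> _ _; rewrite mulrACA exprD.
have N W W' : W.[a] != 0 -> W'.[a] != 0 -> ~~ root (W * W') a.
  by move=> wa wa'; rewrite rootM negb_or /root wa wa'.
move: E; rewrite !M // => E.
have ij : (i + l = k + j)%N.
  by move/(congr1 (multiplicity a)): E; rewrite !cofactor_XsubC_mu ?N.
split.
  by rewrite oE mE; apply/eqP; rewrite subr_eq addrAC eq_sym subr_eq -!PoszD ij.
have {}E : U * V' = U' * V by apply: (mulIf (X0 (i + l)%N)); rewrite E ij.
by apply/eqP; rewrite eqr_div // -!hornerM E.
Qed.

Lemma ind_at_eq0 x f : ~~ root (denom f) x -> ind_at x f = 0.
Proof.
move=> dx; rewrite /ind_at /ind_right /ind_left.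
by rewrite /frac_order (muNroot dx) subr0 ltNge le0z_nat andbF subrr.
Qed.

End CauchyIndex.

Section WindingNumber.
Variable R : rcfType.

(* A piecewise polynomial path [0, 1] -> R[i], given on [t_k, t_(k+1)], k < n,
   by the k-th piece. *)
Record pp_path := PPPath {
  pp_size : nat;
  pp_knot : nat -> R;
  pp_piece : nat -> {poly R[i]};
  pp_knot0 : pp_knot 0 = 0;
  pp_knot1 : pp_knot pp_size = 1;
  pp_knot_lt : forall k, (k < pp_size)%N -> pp_knot k < pp_knot k.+1;
  pp_glue : forall k, (k.+1 < pp_size)%N ->
    (pp_piece k).[(pp_knot k.+1)%:C] = (pp_piece k.+1).[(pp_knot k.+1)%:C]
}.

Definition re_poly (P : {poly R[i]}) : {poly R} :=
  map_poly (@complex.Re R) P.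
Definition im_poly (P : {poly R[i]}) : {poly R} :=
  map_poly (@complex.Im R) P.

Definition winding_number (g : pp_path) : rat :=
  2%:R^-1 * \sum_(k < pp_size g)
    cauchy_index (pp_knot g k) (pp_knot g k.+1)
      ((re_poly (pp_piece g k))%:F / (im_poly (pp_piece g k))%:F).

Lemma pp_comp_glue (F : {poly R[i]}) (g : pp_path) k : (k.+1 < pp_size g)%N ->
  (F \Po pp_piece g k).[(pp_knot g k.+1)%:C]
  = (F \Po pp_piece g k.+1).[(pp_knot g k.+1)%:C].
Proof. by move=> kn; rewrite !horner_comp pp_glue. Qed.

Definition pp_comp (F : {poly R[i]}) (g : pp_path) : pp_path :=
  @PPPath (pp_size g) (pp_knot g) (fun k => F \Po pp_piece g k)
    (pp_knot0 g) (pp_knot1 g) (@pp_knot_lt g) (@pp_comp_glue F g).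

Definition interp_poly (s t : R) (z w : R[i]) : {poly R[i]} :=
  z%:P + ((w - z) / (t - s)%:C) *: ('X - (s%:C)%:P).

Lemma interp_poly_left s t z w : (interp_poly s t z w).[s%:C] = z.
Proof. by rewrite /interp_poly !hornerE subrr mulr0 addr0. Qed.

Lemma interp_poly_right s t z w : s < t -> (interp_poly s t z w).[t%:C] = w.
Proof.
move=> st; rewrite /interp_poly !hornerE -rmorphB divfK ?subrKC //.
by rewrite fmorph_eq0 subr_eq0 gt_eqF.
Qed.

Section Rectangle.
Variables x0 x1 y0 y1 : R.

Definition in_rect (z : R[i]) : bool :=
  (x0 <= complex.Re z <= x1) && (y0 <= complex.Im z <= y1).

Definition rect_corner (k : nat) : R[i] :=
  nth 0 [:: x0 +i* y0; x1 +i* y0; x1 +i* y1; x0 +i* y1; x0 +i* y0] k.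

Definition rect_knot (k : nat) : R := k%:R / 4%:R.

Definition rect_piece (k : nat) : {poly R[i]} :=
  interp_poly (rect_knot k) (rect_knot k.+1) (rect_corner k) (rect_corner k.+1).

Lemma rect_knot0 : rect_knot 0 = 0.
Proof. exact: mul0r. Qed.

Lemma rect_knot1 : rect_knot 4 = 1.
Proof. by rewrite /rect_knot divff // pnatr_eq0. Qed.

Lemma rect_knot_lt k : (k < 4)%N -> rect_knot k < rect_knot k.+1.
Proof. by move=> _; rewrite ltr_pM2r ?ltr_nat // invr_gt0 ltr0n. Qed.

Lemma rect_glue k : (k.+1 < 4)%N ->
  (rect_piece k).[(rect_knot k.+1)%:C] = (rect_piece k.+1).[(rect_knot k.+1)%:C].
Proof.
by move=> k4; rewrite interp_poly_left interp_poly_right // rect_knot_lt // ltnW.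
Qed.

Definition rect_boundary : pp_path :=
  PPPath rect_knot0 rect_knot1 rect_knot_lt rect_glue.

End Rectangle.

(* The modulus |x + iy| as an element of R; the library's `|z| is its image
   in R[i]. *)
Definition cmod (z : R[i]) : R := ComplexField.Normc.normc z.

(* For F monic of degree n, c_(k+1) is the coefficient of degree n - (k+1). *)
Definition cauchy_radius (F : {poly R[i]}) : R :=
  let n := (size F).-1 in
  1 + \big[Num.max/0]_(k < n) cmod F`_(n - k.+1).

End WindingNumber.

(* Main.v *)
(* Since R[i] is algebraically closed, F is a product of linear factors Z - z,
   and |z| < rho_F by Cauchy's bound, so that each z is interior to the
   rectangle. The winding number along a closed path is additive on products of
   polynomials that do not vanish on it, and w(Z - z) = 1 by direct computation:
   only the two vertical sides contribute.

   For the additivity, cut [a, b] at the roots of all the polynomials involved.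
   On a gap with an inner point y, each one-sided index at an end c is a
   function of the signs at c and at y, and a case analysis shows that
   Ind(re F/im F) + Ind(re G/im G) - Ind(re FG/im FG) is half the increment of
   sign(im F im G im FG). Along a closed path the increments cancel. *)
Require Import Defs.
From mathcomp Require Import all_boot all_order all_algebra complex.
From mathcomp Require Import polyorder polyrcf ring lra.
Import Order.TTheory GRing.Theory Num.Theory.
Local Open Scope ring_scope.

(** * One-sided indices read off from signs at nearby points *)

Section CauchyIndex.
Variable R : rcfType.
Implicit Types (a b c x y : R) (p q r s : {poly R}).

Definition noroot_in (i : interval R) p :=
  p != 0 -> {in i, forall x, ~~ root p x}.

Lemma noroot_inW (i j : interval R) p :
  {subset i <= j} -> noroot_in j p -> noroot_in i p.
Proof. by move=> ij pj p0 x /ij; apply: pj. Qed.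

Lemma frac_order_ratio a p q : p != 0 -> q != 0 ->
  frac_order a (p%:F / q%:F) = (\mu_a p)%:Z - (\mu_a q)%:Z /\
  frac_lead a (p%:F / q%:F) = (cofactor_at a p).[a] / (cofactor_at a q).[a].
Proof.
move=> p0 q0; have [pE pa] := cofactor_atP a p0.
have [qE qa] := cofactor_atP a q0.
apply: frac_order_unique => //; rewrite {1}pE {1}qE !tofracM !tofracXn.
by rewrite expfzDr ?XsubCF_neq0 // -exprnN -exprnP invfM mulrACA mulrC.
Qed.

(** Once the power of [X - c] is split off, the cofactor has no root on [i], hence constant sign
    there by the intermediate value property. *)
Lemma sgz_cofactor (i : interval R) c y p : p != 0 -> c \in i -> y \in i ->
  (forall x, x \in i -> x != c -> ~~ root p x) ->
  sgz p.[y] = sgz (cofactor_at c p).[c] * sgz (y - c) ^+ \mu_c p.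
Proof.
move=> p0 ci yi pi; have [pE pc] := cofactor_atP c p0.
rewrite {1}pE hornerM horner_exp !hornerE sgzM sgzX; congr (_ * _).
rewrite -[LHS]sgz_sgr -[RHS]sgz_sgr; congr sgz; apply: polyrN0_itv (ci) (yi).
move=> x xi; have [->|/(pi _ xi)] := eqVneq x c; first exact: pc.
by rewrite {1}pE rootM negb_or => /andP[].
Qed.

Lemma sgz_right a y p : a < y -> noroot_in `]a, y] p -> p != 0 ->
  sgz p.[y] = sgz (cofactor_at a p).[a].
Proof.
move=> ay py p0; rewrite (@sgz_cofactor `[a, y] a) ?in_itv /= ?lexx ?(ltW ay) //.
  by rewrite (gtr0_sgz (x := y - a)) ?subr_gt0 // expr1n mulr1.
move=> x; rewrite in_itv /= => /andP[ax xy] xa; apply: py => //.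
by rewrite in_itv /= xy lt_def xa ax.
Qed.

Lemma sgz_left y b p : y < b -> noroot_in `[y, b[ p -> p != 0 ->
  sgz p.[y] = sgz (cofactor_at b p).[b] * (-1) ^+ \mu_b p.
Proof.
move=> yb py p0; rewrite (@sgz_cofactor `[y, b] b) ?in_itv /= ?lexx ?(ltW yb) //.
  by rewrite (ltr0_sgz (x := y - b)) // subr_lt0.
move=> x; rewrite in_itv /= => /andP[ax xy] xa; apply: py => //.
by rewrite in_itv /= ax lt_def eq_sym xa xy.
Qed.

Lemma frac_order_lt0 a p q : p != 0 -> q != 0 -> ~~ (root p a && root q a) ->
  (frac_order a (p%:F / q%:F) < 0) = root q a.
Proof.
move=> p0 q0; rewrite negb_and; have [-> _] := frac_order_ratio a _ _ p0 q0.
rewrite subr_lt0 ltz_nat -(mu_gt0 a q0).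
case/orP=> [pa|]; first by rewrite (muNroot pa).
by rewrite lt0n negbK => /eqP->; rewrite ltn0.
Qed.

Lemma sgzV x : sgz x^-1 = sgz x.
Proof. by rewrite -[LHS]sgz_sgr sgrV sgz_sgr. Qed.

(** Without a common root, a pole at [a] is exactly a root of [q], and the sign of the leading
    coefficient can be read at [y]. If [p] or [q] is zero, both sides are 0. *)
Lemma ind_rightE a y p q : a < y ->
  noroot_in `]a, y] p -> noroot_in `]a, y] q -> ~~ (root p a && root q a) ->
  ind_right a (p%:F / q%:F) = (root q a)%:R * (sgz (p.[y] * q.[y]))%:~R / 2%:R.
Proof.
move=> ay py qy pqa; rewrite /ind_right.
have [->|p0] := eqVneq p 0.
  by rewrite tofrac0 mul0r eqxx horner0 mul0r sgz0 mulr0 mul0r.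
have [->|q0] := eqVneq q 0.
  by rewrite tofrac0 invr0 mulr0 eqxx horner0 mulr0 sgz0 mulr0 mul0r.
have [_ ->] := frac_order_ratio a _ _ p0 q0.
rewrite mulf_neq0 ?invr_eq0 ?tofrac_eq0 //= frac_order_lt0 //.
case: (root q a); last by rewrite !mul0r.
by rewrite mul1r !sgzM sgzV (sgz_right _ _ _ ay py p0) (sgz_right _ _ _ ay qy q0).
Qed.

Lemma ind_leftE y b p q : y < b ->
  noroot_in `[y, b[ p -> noroot_in `[y, b[ q -> ~~ (root p b && root q b) ->
  ind_left b (p%:F / q%:F) = (root q b)%:R * (sgz (p.[y] * q.[y]))%:~R / 2%:R.
Proof.
move=> yb py qy pqb; rewrite /ind_left.
have [->|p0] := eqVneq p 0.
  by rewrite tofrac0 mul0r eqxx horner0 mul0r sgz0 mulr0 mul0r.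
have [->|q0] := eqVneq q 0.
  by rewrite tofrac0 invr0 mulr0 eqxx horner0 mulr0 sgz0 mulr0 mul0r.
have [E ->] := frac_order_ratio b _ _ p0 q0.
rewrite mulf_neq0 ?invr_eq0 ?tofrac_eq0 //= frac_order_lt0 // E.
case: (root q b); last by rewrite !mul0r.
rewrite mul1r !sgzM sgzV (sgz_left _ b p) // (sgz_left _ b q) //.
(* As -1 is its own inverse, the difference of multiplicities in the order has the parity of their
   sum, which is what [sgz_left] produced. *)
rewrite expfzDr ?oppr_eq0 ?oner_eq0 // -exprnN -exprVn invrN1.
by rewrite -exprnP !rmorphM /= !rmorphXn /= !rmorphN1; ring.
Qed.

Lemma ind_ratio0 a p q : ~~ root q a ->
  ind_right a (p%:F / q%:F) = 0 /\ ind_left a (p%:F / q%:F) = 0.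
Proof.
move=> qa; rewrite /ind_right /ind_left.
have [->|p0] := eqVneq p 0; first by rewrite tofrac0 mul0r eqxx.
have q0 : q != 0 by apply: contraNneq qa => ->; rewrite root0.
by rewrite frac_order_lt0 ?negb_and ?qa ?orbT // (negPf qa) andbF.
Qed.

(** * Additivity over intervals and reduction to root-free gaps *)

Lemma cauchy_indexD a b c (f : {fraction {poly R}}) : a < b -> b < c ->
  cauchy_index a c f = cauchy_index a b f + cauchy_index b c f.
Proof.
move=> ab bc; rewrite /cauchy_index; set d := denom f.
suff -> : \sum_(x <- roots d a c) ind_at x f = \sum_(x <- roots d a b) ind_at x f
    + ind_at b f + \sum_(x <- roots d b c) ind_at x f.
  by rewrite /ind_at; ring.
(* The cut point is listed only when it is a root of [d]; otherwise [ind_at b f] is 0 anyway. *)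
pose S := roots d a b ++ (if root d b then [:: b] else [::]) ++ roots d b c.
have -> : \sum_(x <- roots d a c) ind_at x f = \sum_(x <- S) ind_at x f.
  apply: perm_big; apply: uniq_perm; first exact: uniq_roots.
    rewrite !cat_uniq !uniq_roots /= -!all_predC; apply/and4P; split => //.
    - apply/allP => x /=; rewrite mem_cat !in_roots !in_itv /=.
      case: ifP => _; rewrite ?inE ?in_nil /=; last first.
        by case/and3P=> _ /andP[bx _] _; rewrite [x < b]ltNge (ltW bx) !andbF.
      case/orP=> [/eqP->|]; first by rewrite ltxx !andbF.
      by case/and3P=> _ /andP[bx _] _; rewrite [x < b]ltNge (ltW bx) !andbF.
    - by case: ifP.
    - apply/allP=> x; rewrite in_roots in_itv /= => /and3P[_ /andP[bx _] _].
      by case: ifP => //= _; rewrite inE gt_eqF.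
  move=> x; rewrite !mem_cat !in_roots !in_itv /= denom_neq0 !andbT.
  have -> : (x \in (if root d b then [:: b] else [::])) = root d x && (x == b).
    by case: ifP => h; rewrite ?inE ?in_nil; case: eqP => [->|]; rewrite ?h ?andbF.
  case: (root d x) => //=; case: (ltgtP x b) => [xb|bx|->]; rewrite ?ab ?bc //=.
  - by rewrite (lt_trans xb bc) !andbT orbF.
  - by rewrite (lt_trans ab bx) andbF.
rewrite /S !big_cat /= addrA; congr (_ + _ + _).
case: ifPn => [_|/ind_at_eq0->]; first by rewrite big_seq1.
by rewrite big_nil.
Qed.

Lemma cauchy_index_gap a b p q : noroot_in `]a, b[ q ->
  cauchy_index a b (p%:F / q%:F)
  = ind_right a (p%:F / q%:F) - ind_left b (p%:F / q%:F).
Proof.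
move=> qab; rewrite /cauchy_index; congr (_ - _).
(* [denom] belongs to a chosen representative and may have roots that [q] lacks; there the index is
   0. *)
rewrite [X in _ + X]big_seq big1 ?addr0 // => x.
rewrite in_roots => /and3P[_ xab _].
have [->|q0] := eqVneq q 0.
  by rewrite tofrac0 invr0 mulr0 /ind_at /ind_right /ind_left eqxx subrr.
by rewrite /ind_at; have [-> ->] := ind_ratio0 x p q (qab q0 x xab); rewrite subrr.
Qed.

(** Induction on the number of roots of [h] in the open interval: cutting at a root leaves fewer on
    each side. [P] carries hypotheses inherited by subintervals. *)
Lemma additive_vanish (V : zmodType) (Phi : R -> R -> V) (P : R -> R -> Prop) h :
  h != 0 ->
  (forall a b a' b', P a b -> a <= a' -> b' <= b -> P a' b') ->
  (forall a b c, a < b -> b < c -> Phi a c = Phi a b + Phi b c) ->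
  (forall a b, a < b -> P a b -> noroot_in `]a, b[ h -> Phi a b = 0) ->
  forall a b, a < b -> P a b -> Phi a b = 0.
Proof.
move=> h0 Psub PhiD Phi0 a b.
have [n] := ubnP (size (roots h a b)); elim: n a b => // n IHn a b sn ab Pab.
case E : (roots h a b) => [|x s].
  apply: Phi0 => // _ x xab; apply/negP => hx.
  by have := in_roots h a b x; rewrite E in_nil hx xab h0.
have xr : x \in roots h a b by rewrite E mem_head.
have := xr; rewrite in_roots in_itv /= => /and3P[hx /andP[ax xb] _].
have lt_size c d : a <= c -> d <= b -> x \notin `]c, d[ ->
    (size (roots h c d) < size (roots h a b))%N.
  move=> ac db xcd; apply: (@leq_trans (size (x :: roots h c d))) => //.
  apply: uniq_leq_size => [|y].
    by rewrite /= uniq_roots in_roots (negPf xcd) andbF.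
  rewrite inE => /orP[/eqP->//|]; rewrite !in_roots !in_itv /=.
  by case/and3P=> -> /andP[cy yd] ->; rewrite (le_lt_trans ac) ?(lt_le_trans yd).
have Phiax : Phi a x = 0.
  apply: IHn => //; last by apply: Psub Pab _ _; rewrite ?lexx ?ltW.
  by apply: leq_trans (lt_size _ _ _ _ _) _;
    rewrite ?lexx ?(ltW xb) ?in_itv /= ?ltxx ?andbF.
have Phixb : Phi x b = 0.
  apply: IHn => //; last by apply: Psub Pab _ _; rewrite ?lexx ?ltW.
  by apply: leq_trans (lt_size _ _ _ _ _) _;
    rewrite ?lexx ?(ltW ax) ?in_itv /= ?ltxx ?andbF.
by rewrite (PhiD _ x) // Phiax Phixb addr0.
Qed.

(** Replacing zero factors by 1 makes the product nonzero, so that it can serve as the [h] of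
    [additive_vanish]. *)
Lemma noroot_in_prod (i : interval R) (us : seq {poly R}) u :
  u \in us ->
  noroot_in i (\prod_(v <- us) (if v == 0 then 1 else v)) -> noroot_in i u.
Proof.
move=> uus; rewrite (big_rem u) //= => H u0 x xi.
have := H _ x xi; rewrite (negPf u0) rootM negb_or => /(_ _)/andP[]//.
rewrite mulf_neq0 // prodf_seq_neq0; apply/allP => v _ /=.
by case: (eqVneq v 0) => //; rewrite oner_neq0.
Qed.

(** * Product formula for the Cauchy index *)

Lemma noroot_sgz (i : interval R) c y p : c \in i -> y \in i ->
  (forall x, x \in i -> x != c -> p != 0 -> ~~ root p x) -> p.[c] != 0 ->
  sgz p.[y] = sgz p.[c].
Proof.
move=> ci yi pi pc; have p0 : p != 0 by apply: contraNneq pc => ->; rewrite horner0.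
rewrite -[LHS]sgz_sgr -[RHS]sgz_sgr; congr sgz; apply: polyrN0_itv (ci) (yi).
by move=> x xi; have [->|/pi->] := eqVneq x c.
Qed.

Lemma noroot_sgz_right a y p : a < y -> noroot_in `]a, y] p -> p.[a] != 0 ->
  sgz p.[y] = sgz p.[a].
Proof.
move=> ay py; apply: (@noroot_sgz `[a, y]); rewrite ?in_itv /= ?lexx ?(ltW ay) //.
move=> x; rewrite in_itv /= => /andP[ax xy] xa p0; apply: py => //.
by rewrite in_itv /= xy lt_def xa ax.
Qed.

Lemma noroot_sgz_left y b p : y < b -> noroot_in `[y, b[ p -> p.[b] != 0 ->
  sgz p.[y] = sgz p.[b].
Proof.
move=> yb py; apply: (@noroot_sgz `[y, b]); rewrite ?in_itv /= ?lexx ?(ltW yb) //.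
move=> x; rewrite in_itv /= => /andP[ax xy] xa p0; apply: py => //.
by rewrite in_itv /= ax lt_def eq_sym xa xy.
Qed.

(* Read [u0] as the value of a polynomial at an end of an interval, [u] as its
   value inside, the polynomial being zero or without root in between. *)
Definition germ_sign (u u0 : R) := u0 != 0 -> sgz u = sgz u0.

(** The failure of the sign to be additive; needed for [im = p * s + q * r] when all three fractions
    have a pole. *)
Lemma sgzD x y :
  sgz x + sgz y - sgz (x + y) = sgz x * sgz y * sgz (x + y).
Proof.
case: (sgzP x) => x_; case: (sgzP y) => y_; case: (sgzP (x + y)) => xy_ //;
  exfalso; lra.
Qed.

(** The product formula localized at one end of a gap: the left side is twice the combination of
    one-sided indices there. The cases say which fractions have a pole. *)
Lemma germ_sign_mul (p0 q0 r0 s0 p q r s : R) :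
  let re0 := p0 * r0 - q0 * s0 in let im0 := p0 * s0 + q0 * r0 in
  let re := p * r - q * s in let im := p * s + q * r in
  germ_sign p p0 -> germ_sign q q0 -> germ_sign r r0 -> germ_sign s s0 ->
  germ_sign re re0 -> germ_sign im im0 ->
  ~~ ((p0 == 0) && (q0 == 0)) -> ~~ ((r0 == 0) && (s0 == 0)) ->
  (q0 == 0)%:Z * sgz (p * q) + (s0 == 0)%:Z * sgz (r * s)
    - (im0 == 0)%:Z * sgz (re * im)
  = sgz (q * s * im) - sgz (q0 * s0 * im0).
Proof.
move=> re0 im0 re im gp gq gr gs gre gim; rewrite !negb_and.
have [q00|q00] := eqVneq q0 0; have [s00|s00] := eqVneq s0 0.
- rewrite !orbF => p00 r00; have re0N : re0 != 0.
    by rewrite /re0 q00 mul0r subr0 mulf_neq0.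
  have -> : im0 = 0 by rewrite /im0 q00 s00 mulr0 mul0r addr0.
  rewrite eqxx q00 !mul0r sgz0 subr0 !mul1r.
  have pN : p != 0 by rewrite -sgz_eq0 gp // sgz_eq0.
  have rN : r != 0 by rewrite -sgz_eq0 gr // sgz_eq0.
  have reE : sgz re = sgz p * sgz r.
    by rewrite gre // /re0 q00 mul0r subr0 sgzM gp ?gr.
  have := sgzD (p * s) (q * r); rewrite -/im !sgzM reE.
  have : sgz p * sgz p = 1 by rewrite mulz_sg pN.
  have : sgz r * sgz r = 1 by rewrite mulz_sg rN.
  move: (sgz p) (sgz q) (sgz r) (sgz s) (sgz im) => P Q S T I SS PP E.
  (* [E] is multiplied by [P * S], whose square is 1. *)
  transitivity (P * S * (P * T + Q * S - I)).
    by rewrite -[P * Q]mulr1 -SS -[S * T]mulr1 -PP; ring.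
  by rewrite E -[RHS]mulr1 -[in RHS]PP -[RHS]mulr1 -[in RHS]SS; ring.
(* Only the first fraction has a pole, and [im] has the sign of [p * s]; the next case is
   symmetric. *)
- rewrite orbF => p00 _; have imN : im0 != 0.
    by rewrite /im0 q00 mul0r addr0 mulf_neq0.
  rewrite (negPf imN) q00 !mul0r sgz0 subr0 addr0 subr0 mul1r.
  rewrite !sgzM gim // /im0 q00 mul0r addr0 sgzM -gp // -gs //.
  have : sgz s * sgz s = 1 by rewrite gs // mulz_sg s00.
  move: (sgz p) (sgz q) (sgz s) => x y z zz.
  by rewrite mulrACA [y * x]mulrC zz mulr1.
- move=> _; rewrite orbF => r00; have imN : im0 != 0.
    by rewrite /im0 s00 mulr0 add0r mulf_neq0.
  rewrite (negPf imN) s00 !mulr0 !mul0r sgz0 subr0 add0r subr0 mul1r.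
  rewrite !sgzM gim // /im0 s00 mulr0 add0r sgzM -gr // -gq //.
  have : sgz q * sgz q = 1 by rewrite gq // mulz_sg q00.
  move: (sgz q) (sgz r) (sgz s) => x y z zz.
  by rewrite mulrACA zz mul1r mulrC.
move=> _ _; rewrite !mul0r add0r.
have [im00|im00] := eqVneq im0 0; last first.
  by rewrite mul0r oppr0 !sgzM gq // gs // gim // subrr.
rewrite im00 mulr0 sgz0 subr0 mul1r.
(* Only the product has a pole: [im0 = 0] turns [q0 * s0 * re0] into minus a sum of squares, so [re]
   and [q * s] have opposite signs. *)
have reN : q0 * s0 * re0 < 0.
  have -> : q0 * s0 * re0 = - ((q0 * r0) ^+ 2 + (q0 * s0) ^+ 2).
    rewrite /re0; have : p0 * s0 = - (q0 * r0) by apply/eqP; rewrite -addr_eq0 -im00.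
    by move=> E; rewrite mulrBr mulrACA [s0 * r0]mulrC mulrA; ring: E.
  by rewrite oppr_lt0 ltr_wpDl ?sqr_ge0 // exprn_even_gt0 //= mulf_neq0.
have re0N : re0 != 0 by apply: contraTneq reN => ->; rewrite mulr0 ltxx.
have : sgz (q0 * s0 * re0) = -1 by exact: ltr0_sgz.
rewrite !sgzM -gq // -gs // -gre //.
have : sgz re * sgz re = 1 by rewrite gre // mulz_sg re0N.
move: (sgz re) (sgz q * sgz s) => x y xx yx.
have -> : y = - x by rewrite -[y]mulr1 -xx mulrA yx mulN1r.
by rewrite mulNr.
Qed.

Lemma sqrD_eq0 x y : (x ^+ 2 + y ^+ 2 == 0) = (x == 0) && (y == 0).
Proof. by rewrite paddr_eq0 ?sqr_ge0 // !sqrf_eq0. Qed.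

(** [germ_sign_mul] is used at both ends with the same inner point; subtracting cancels the sign
    there. *)
Lemma cauchy_index_mul_gap a b p q r s : a < b ->
  (forall x, a <= x <= b -> ~~ (root p x && root q x)) ->
  (forall x, a <= x <= b -> ~~ (root r x && root s x)) ->
  let re := p * r - q * s in let im := p * s + q * r in
  {in [:: p; q; r; s; re; im], forall u, noroot_in `]a, b[ u} ->
  cauchy_index a b (p%:F / q%:F) + cauchy_index a b (r%:F / s%:F)
    - cauchy_index a b (re%:F / im%:F)
  = (sgz (q * s * im).[b] - sgz (q * s * im).[a])%:~R / 2%:R.
Proof.
move=> ab pq rs re im gap.
(* Multiplicativity of the squared modulus. *)
have reim x : a <= x <= b -> ~~ (root re x && root im x).
  move=> xab; have := pq x xab; have := rs x xab.
  rewrite /root -!sqrD_eq0 /re /im !hornerE => rs0 pq0.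
  suff -> : forall P Q S T : R, (P * S - Q * T) ^+ 2 + (P * T + Q * S) ^+ 2
    = (P ^+ 2 + Q ^+ 2) * (S ^+ 2 + T ^+ 2) by rewrite mulf_neq0.
  by move=> *; ring.
pose y := (a + b) / 2.
have ay : a < y by rewrite /y; lra.
have yb : y < b by rewrite /y; lra.
have gapl u : u \in [:: p; q; r; s; re; im] -> noroot_in `]a, y] u.
  move=> /gap; apply: noroot_inW => x; rewrite !in_itv /= => /andP[-> xy].
  by rewrite (le_lt_trans xy).
have gapr u : u \in [:: p; q; r; s; re; im] -> noroot_in `[y, b[ u.
  move=> /gap; apply: noroot_inW => x; rewrite !in_itv /= => /andP[xy ->].
  by rewrite (lt_le_trans ay).
have aab : a <= a <= b by rewrite lexx ltW.
have bab : a <= b <= b by rewrite lexx ltW.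
have germa u : u \in [:: p; q; r; s; re; im] -> germ_sign u.[y] u.[a].
  by move=> /gapl; apply: noroot_sgz_right.
have germb u : u \in [:: p; q; r; s; re; im] -> germ_sign u.[y] u.[b].
  by move=> /gapr; apply: noroot_sgz_left.
have reE x : re.[x] = p.[x] * r.[x] - q.[x] * s.[x] by rewrite /re !hornerE.
have imE x : im.[x] = p.[x] * s.[x] + q.[x] * r.[x] by rewrite /im !hornerE.
rewrite !cauchy_index_gap; try by apply: gap; rewrite !inE eqxx ?orbT.
rewrite !(ind_rightE _ y) ?pq ?rs ?reim //; try by apply: gapl; rewrite !inE eqxx ?orbT.
rewrite !(ind_leftE y) ?pq ?rs ?reim //; try by apply: gapr; rewrite !inE eqxx ?orbT.
have Ea : (q.[a] == 0)%:Z * sgz (p.[y] * q.[y]) + (s.[a] == 0)%:Z * sgz (r.[y] * s.[y])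
    - (im.[a] == 0)%:Z * sgz (re.[y] * im.[y])
    = sgz (q.[y] * s.[y] * im.[y]) - sgz (q.[a] * s.[a] * im.[a]).
  by rewrite !reE !imE; apply: germ_sign_mul; rewrite -?reE -?imE ?(pq _ aab) ?(rs _ aab) //;
    apply: germa; rewrite !inE eqxx ?orbT.
have Eb : (q.[b] == 0)%:Z * sgz (p.[y] * q.[y]) + (s.[b] == 0)%:Z * sgz (r.[y] * s.[y])
    - (im.[b] == 0)%:Z * sgz (re.[y] * im.[y])
    = sgz (q.[y] * s.[y] * im.[y]) - sgz (q.[b] * s.[b] * im.[b]).
  by rewrite !reE !imE; apply: germ_sign_mul; rewrite -?reE -?imE ?(pq _ bab) ?(rs _ bab) //;
    apply: germb; rewrite !inE eqxx ?orbT.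
rewrite /root !hornerM.
have {Ea}/(congr1 (fun z : int => z%:~R : rat)) := Ea.
have {Eb}/(congr1 (fun z : int => z%:~R : rat)) := Eb.
rewrite !rmorphB !rmorphD /= ![(_%:Z * _)%:~R]rmorphM /= => Eb Ea.
lra.
Qed.

(* The product formula for two complex polynomials [p + i q] and [r + i s]; the
   right-hand side only depends on their values at [a] and [b], hence cancels
   along closed paths. *)
Lemma cauchy_index_mul a b p q r s : a < b ->
  (forall x, a <= x <= b -> ~~ (root p x && root q x)) ->
  (forall x, a <= x <= b -> ~~ (root r x && root s x)) ->
  let re := p * r - q * s in let im := p * s + q * r in
  cauchy_index a b (p%:F / q%:F) + cauchy_index a b (r%:F / s%:F)
    - cauchy_index a b (re%:F / im%:F)
  = (sgz (q * s * im).[b] - sgz (q * s * im).[a])%:~R / 2%:R.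
Proof.
move=> ab pq rs re im; set e := q * s * im.
pose us := [:: p; q; r; s; re; im].
pose h := \prod_(u <- us) (if u == 0 then 1 else u).
have h0 : h != 0.
  rewrite prodf_seq_neq0; apply/allP => v _ /=.
  by case: (eqVneq v 0) => //; rewrite oner_neq0.
(* The defect of the formula is additive over intervals, its last term being an increment. *)
pose Phi a b := cauchy_index a b (p%:F / q%:F) + cauchy_index a b (r%:F / s%:F)
    - cauchy_index a b (re%:F / im%:F) - (sgz e.[b] - sgz e.[a])%:~R / 2%:R.
pose P a b := (forall x, a <= x <= b -> ~~ (root p x && root q x)) /\
  (forall x, a <= x <= b -> ~~ (root r x && root s x)).
apply/eqP; rewrite -subr_eq0; apply/eqP.
apply: (@additive_vanish _ Phi P h) => //.
- move=> c d c' d' [cdp cdr] cc dd; split=> x /andP[xc xd].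
    by apply: cdp; rewrite (le_trans cc) ?(le_trans xd).
  by apply: cdr; rewrite (le_trans cc) ?(le_trans xd).
- move=> c d c' cd dc; rewrite /Phi !(cauchy_indexD c d c') // !rmorphB /=; ring.
- move=> c d cd [cdp cdr] gap; apply/eqP; rewrite subr_eq0; apply/eqP.
  apply: cauchy_index_mul_gap => // u uus; exact: noroot_in_prod uus gap.
Qed.

Lemma cauchy_index0 a b : cauchy_index a b (0 : {fraction {poly R}}) = 0.
Proof.
have r0 x : ind_right x (0 : {fraction {poly R}}) = 0 by rewrite /ind_right eqxx.
have l0 x : ind_left x (0 : {fraction {poly R}}) = 0 by rewrite /ind_left eqxx.
rewrite /cauchy_index r0 l0 big1 ?addr0 ?subr0 // => x _.
by rewrite /ind_at r0 l0 subrr.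
Qed.

Lemma cauchy_index_noroot_den a b p q : a < b ->
  (forall x, a <= x <= b -> ~~ root q x) ->
  cauchy_index a b (p%:F / q%:F) = 0.
Proof.
move=> ab qab; rewrite cauchy_index_gap => [|_ x]; last first.
  by rewrite in_itv /= => /andP[ax xb]; apply: qab; rewrite !ltW.
have [|-> _] := ind_ratio0 a p q; first by rewrite qab // lexx ltW.
by have [|_ ->] := ind_ratio0 b p q; rewrite ?subrr // qab // lexx ltW.
Qed.

(* The inversion formula, i.e. the product formula with the constant [i]. *)
Lemma cauchy_index_noroot_num a b p q : a < b ->
  (forall x, a <= x <= b -> ~~ root p x) ->
  cauchy_index a b (p%:F / q%:F)
  = (sgz (q.[b] * p.[b]) - sgz (q.[a] * p.[a]))%:~R / 2%:R.
Proof.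
move=> ab pab; have := @cauchy_index_mul a b p q 0 1 ab.
rewrite tofrac0 mul0r cauchy_index0 !mulr0 !mulr1 sub0r !addr0 => H.
rewrite -!hornerM -H => [|x /pab px|x _]; rewrite ?negb_and ?px //.
  (* Multiplying by [i] gives real part [- q] and imaginary part [p], whose quotient has no pole. *)
  by rewrite (cauchy_index_noroot_den _ _ (- q)) // subr0.
by rewrite root1 orbT.
Qed.

End CauchyIndex.

(** * Winding numbers of products along closed paths *)

Section WindingNumber.
Variable R : rcfType.
Implicit Types (P Q F G : {poly R[i]}) (z w : R[i]) (g : pp_path R).

Lemma re_polyE P k : (re_poly P)`_k = complex.Re P`_k.
Proof. by rewrite coef_map_id0. Qed.

Lemma im_polyE P k : (im_poly P)`_k = complex.Im P`_k.
Proof. by rewrite coef_map_id0. Qed.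

Lemma re_polyM P Q :
  re_poly (P * Q) = re_poly P * re_poly Q - im_poly P * im_poly Q.
Proof.
apply/polyP => k; rewrite re_polyE coefB !coefM raddf_sum -sumrB.
apply: eq_bigr => j _; rewrite !re_polyE !im_polyE.
by case: (P`_j) (Q`_(k - j)) => [a b] [c d].
Qed.

Lemma im_polyM P Q :
  im_poly (P * Q) = re_poly P * im_poly Q + im_poly P * re_poly Q.
Proof.
apply/polyP => k; rewrite im_polyE coefD !coefM raddf_sum -big_split.
apply: eq_bigr => j _; rewrite !re_polyE !im_polyE.
by case: (P`_j) (Q`_(k - j)) => [a b] [c d].
Qed.

Lemma horner_reim P (t : R) :
  complex.Re P.[t%:C%C] = (re_poly P).[t] /\ complex.Im P.[t%:C%C] = (im_poly P).[t].
Proof.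
rewrite horner_coef (horner_coef_wide _ (size_poly _ _)).
rewrite (horner_coef_wide _ (size_poly _ _)) !raddf_sum.
split; apply: eq_bigr => j _; rewrite ?re_polyE ?im_polyE -rmorphXn /=;
  by case: (P`_j) => a b /=; rewrite mulr0 ?subr0 ?add0r.
Qed.

Definition nonvanishing_on F g := forall k (t : R), (k < pp_size g)%N ->
  pp_knot g k <= t <= pp_knot g k.+1 -> F.[(pp_piece g k).[t%:C%C]] != 0.

Lemma nonvanishing_root F g k (t : R) : nonvanishing_on F g -> (k < pp_size g)%N ->
  pp_knot g k <= t <= pp_knot g k.+1 ->
  ~~ (root (re_poly (F \Po pp_piece g k)) t && root (im_poly (F \Po pp_piece g k)) t).
Proof.
move=> Fg kg /(Fg k t kg); rewrite -horner_comp; apply: contraNN.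
have [ReE ImE] := horner_reim (F \Po pp_piece g k) t.
by rewrite /root -ReE -ImE eq_complex.
Qed.

Definition pp_closed g :=
  (pp_piece g (pp_size g).-1).[1] = (pp_piece g 0).[0].

Lemma winding_number_mul F G g : pp_closed g ->
  nonvanishing_on F g -> nonvanishing_on G g ->
  winding_number (pp_comp (F * G) g)
  = winding_number (pp_comp F g) + winding_number (pp_comp G g).
Proof.
move=> gC Fg Gg; rewrite /winding_number -mulrDr; congr (_ * _) => /=.
apply/eqP; rewrite eq_sym -subr_eq0 -big_split -sumrB /=; apply/eqP.
pose phi z := sgz (complex.Im F.[z] * complex.Im G.[z] * complex.Im (F.[z] * G.[z])).
(* The last knot is sent back to the starting point, so that closedness makes [ptS] hold for the
   last piece too and the sum telescopes to 0. *)
pose pt k := if (k < pp_size g)%N then (pp_piece g k).[(pp_knot g k)%:C%C]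
             else (pp_piece g 0).[0].
have ptS k : (k < pp_size g)%N -> (pp_piece g k).[(pp_knot g k.+1)%:C%C] = pt k.+1.
  move=> kg; rewrite /pt; case: ifPn => [/pp_glue->//|].
  rewrite -leqNgt => gk; have E : pp_size g = k.+1 by apply/eqP; rewrite eqn_leq gk kg.
  by rewrite -gC E /= -E pp_knot1.
transitivity (\sum_(k < pp_size g) ((phi (pt k.+1) - phi (pt k))%:~R / 2%:R : rat)).
  apply: eq_bigr => k _; have kg := ltn_ord k; rewrite comp_polyM re_polyM im_polyM.
  rewrite cauchy_index_mul ?pp_knot_lt //; try by move=> x; apply: nonvanishing_root.
  rewrite -im_polyM -comp_polyM !hornerM.
  have ImE H (t : R) : (im_poly (H \Po pp_piece g k)).[t]
      = complex.Im H.[(pp_piece g k).[t%:C%C]].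
    by rewrite -horner_comp; have [_ ->] := horner_reim (H \Po pp_piece g k) t.
  have ptk : pt k = (pp_piece g k).[(pp_knot g k)%:C%C] by rewrite /pt kg.
  by rewrite !ImE -ptS // ptk /phi !hornerM.
rewrite -mulr_suml -rmorph_sum /= -(big_mkord xpredT (fun k => phi (pt k.+1) - phi (pt k))).
rewrite telescope_sumr // /pt ltnn.
have -> : (0 < pp_size g)%N.
  by rewrite lt0n; apply/eqP => E; have := pp_knot1 g;
    rewrite E pp_knot0 => /eqP; rewrite eq_sym oner_eq0.
by rewrite pp_knot0 subrr mul0r.
Qed.

(** The imaginary part is identically zero, so the convention for a zero denominator applies. *)
Lemma winding_number1 g : winding_number (pp_comp 1 g) = 0.
Proof.
rewrite /winding_number big1 ?mulr0 // => k _ /=.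
suff -> : im_poly (1 \Po pp_piece g k) = 0 by rewrite tofrac0 invr0 mulr0 cauchy_index0.
apply/polyP => j; rewrite im_polyE comp_polyC coef0 coef1.
by case: (j == 0%N).
Qed.

Lemma Re_interp (s t u : R) z w : complex.Re z = complex.Re w ->
  complex.Re (interp_poly s t z w).[u%:C%C] = complex.Re z.
Proof.
move=> zw; rewrite /interp_poly !hornerE -!rmorphB -fmorphV.
case: z w zw => [a b] [c d] /= ->; ring.
Qed.

Lemma Im_interp (s t u : R) z w : complex.Im z = complex.Im w ->
  complex.Im (interp_poly s t z w).[u%:C%C] = complex.Im z.
Proof.
move=> zw; rewrite /interp_poly !hornerE -!rmorphB -fmorphV.
case: z w zw => [a b] [c d] /= ->; ring.
Qed.

(** * Linear factors along the boundary of a rectangle *)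

Section Rectangle.
Variables x0 x1 y0 y1 : R.

Definition rect_interior z :=
  (x0 < complex.Re z < x1) && (y0 < complex.Im z < y1).

Let side := rect_piece x0 x1 y0 y1.

Lemma rect_side (t : R) :
  [/\ complex.Im (side 0).[t%:C%C] = y0, complex.Re (side 1).[t%:C%C] = x1,
      complex.Im (side 2).[t%:C%C] = y1 & complex.Re (side 3).[t%:C%C] = x0].
Proof. by split; rewrite /side ?Im_interp ?Re_interp. Qed.

Lemma rect_boundary_closed : pp_closed (rect_boundary x0 x1 y0 y1).
Proof.
rewrite /pp_closed /= /rect_piece.
rewrite -[X in _.[X] = _](rmorph1 (real_complex R)).
rewrite -[X in _ = _.[X]](rmorph0 (real_complex R)).
rewrite -{1}(rect_knot1 R) -(rect_knot0 R).
by rewrite interp_poly_right ?rect_knot_lt // interp_poly_left.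
Qed.

Lemma XsubC_nonvanishing z : rect_interior z ->
  nonvanishing_on ('X - z%:P) (rect_boundary x0 x1 y0 y1).
Proof.
case/andP=> /andP[zx0 zx1] /andP[zy0 zy1] k t /= k4 _.
rewrite hornerXsubC subr_eq0; have := rect_side t; rewrite /side => -[s0 s1 s2 s3].
case: k k4 => [|[|[|[|//]]]] _; apply/eqP.
- by move/(congr1 (@complex.Im R)); rewrite s0 => E; rewrite E ltxx in zy0.
- by move/(congr1 (@complex.Re R)); rewrite s1 => E; rewrite E ltxx in zx1.
- by move/(congr1 (@complex.Im R)); rewrite s2 => E; rewrite E ltxx in zy1.
- by move/(congr1 (@complex.Re R)); rewrite s3 => E; rewrite E ltxx in zx0.
Qed.

Lemma winding_number_XsubC z : rect_interior z ->
  winding_number (pp_comp ('X - z%:P) (rect_boundary x0 x1 y0 y1)) = 1.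
Proof.
case/andP=> /andP[zx0 zx1] /andP[zy0 zy1].
have k_lt k : (k < 4)%N -> rect_knot R k < rect_knot R k.+1 by apply: rect_knot_lt.
have re_side k (t : R) : (re_poly (('X - z%:P) \Po side k)).[t]
    = complex.Re (side k).[t%:C%C] - complex.Re z.
  have [<- _] := horner_reim (('X - z%:P) \Po side k) t.
  by rewrite horner_comp !hornerE raddfB.
have im_side k (t : R) : (im_poly (('X - z%:P) \Po side k)).[t]
    = complex.Im (side k).[t%:C%C] - complex.Im z.
  have [_ <-] := horner_reim (('X - z%:P) \Po side k) t.
  by rewrite horner_comp !hornerE raddfB.
have sideL k : (side k).[(rect_knot R k)%:C%C] = rect_corner x0 x1 y0 y1 k.
  exact: interp_poly_left.
have sideR k : (k < 4)%N ->
    (side k).[(rect_knot R k.+1)%:C%C] = rect_corner x0 x1 y0 y1 k.+1.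
  by move=> k4; apply: interp_poly_right; apply: k_lt.
rewrite /winding_number /= !big_ord_recl big_ord0 /= !/bump /=.
rewrite !add1n -/side.
(* On horizontal sides the imaginary part is a nonzero constant, so the index is 0; on vertical
   sides the real part is one, so the inversion formula applies. *)
rewrite cauchy_index_noroot_den ?k_lt // => [|t _]; last first.
  by have [s _ _ _] := rect_side t; rewrite /root im_side s subr_eq0 lt_eqF.
rewrite cauchy_index_noroot_num ?k_lt // => [|t _]; last first.
  by have [_ s _ _] := rect_side t; rewrite /root re_side s subr_eq0 gt_eqF.
rewrite cauchy_index_noroot_den ?k_lt // => [|t _]; last first.
  by have [_ _ s _] := rect_side t; rewrite /root im_side s subr_eq0 gt_eqF.
rewrite cauchy_index_noroot_num ?k_lt // => [|t _]; last first.
  by have [_ _ _ s] := rect_side t; rewrite /root re_side s subr_eq0 lt_eqF.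
(* Each vertical side gives 1, since both the direction of travel and the sign of the real part are
   reversed between the two; half of the total 2 is 1. *)
rewrite !re_side !im_side !sideL !sideR //= !sgzM.
rewrite !(gtr0_sgz (x := y1 - _)) ?subr_gt0 // !(ltr0_sgz (x := y0 - _)) ?subr_lt0 //.
by rewrite (gtr0_sgz (x := x1 - _)) ?subr_gt0 // (ltr0_sgz (x := x0 - _)) ?subr_lt0.
Qed.

(** Nonvanishing is carried through the induction because [winding_number_mul] requires it of the
    remaining product. *)
Lemma winding_number_prod_XsubC (s : seq R[i]) : all rect_interior s ->
  nonvanishing_on (\prod_(z <- s) ('X - z%:P)) (rect_boundary x0 x1 y0 y1) /\
  winding_number (pp_comp (\prod_(z <- s) ('X - z%:P)) (rect_boundary x0 x1 y0 y1))
    = (size s)%:R.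
Proof.
elim: s => [|z s IHs] /=.
  by rewrite big_nil winding_number1; split=> // k t _ _; rewrite hornerE oner_neq0.
case/andP=> zi /IHs[sn sw]; rewrite big_cons; split.
  by move=> k t k4 tk; rewrite hornerM mulf_neq0 ?sn ?XsubC_nonvanishing.
rewrite winding_number_mul ?sw ?winding_number_XsubC ?mulrS //.
  exact: rect_boundary_closed.
exact: XsubC_nonvanishing.
Qed.

End Rectangle.

(** * The modulus and Cauchy's bound on zeros *)

Lemma cmod_sum (I : Type) (r : seq I) (P : pred I) (f : I -> R[i]) :
  cmod (\sum_(i <- r | P i) f i) <= \sum_(i <- r | P i) cmod (f i).
Proof.
elim/big_rec2: _ => [|i a b _ ab]; first by rewrite /cmod ComplexField.Normc.normc0.
by apply: le_trans (le_normcD _ _) _; rewrite lerD2l.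
Qed.

Lemma cmodM z w : cmod (z * w) = cmod z * cmod w.
Proof. exact: ComplexField.Normc.normcM. Qed.

Lemma cmodX z n : cmod (z ^+ n) = cmod z ^+ n.
Proof.
elim: n => [|n IHn]; first exact: ComplexField.Normc.normc1.
by rewrite !exprS cmodM IHn.
Qed.

Lemma cmod_ge0 z : 0 <= cmod z.
Proof. by case: z => a b; apply: sqrtr_ge0. Qed.

Lemma ler_Re_cmod z : `|complex.Re z| <= cmod z.
Proof.
case: z => a b; rewrite /cmod /= -sqrtr_sqr ler_sqrt ?addr_ge0 ?sqr_ge0 //.
by rewrite lerDl sqr_ge0.
Qed.

Lemma ler_Im_cmod z : `|complex.Im z| <= cmod z.
Proof.
case: z => a b; rewrite /cmod /= -sqrtr_sqr ler_sqrt ?addr_ge0 ?sqr_ge0 //.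
by rewrite lerDr sqr_ge0.
Qed.

(** If [r = cmod z] were at least [1 + M], then [r ^ n] would be at most [M] times the sum of the
    [r ^ i] for [i < n], hence at most [r - 1] times it, which is [r ^ n - 1]. *)
Lemma cauchy_radius_root F z : F \is monic -> root F z -> cmod z < cauchy_radius F.
Proof.
move=> Fm Fz; rewrite ltNge; apply/negP; rewrite /cauchy_radius.
set n := (size F).-1; set M := \big[_/_]_(_ < _) _; set r := cmod z => Mr.
have M0 : 0 <= M.
  by rewrite /M; elim/big_rec: _ => // i x _ x0; rewrite le_max x0 orbT.
have FM (i : 'I_n) : cmod F`_i <= M.
  (* The radius lists coefficients from the top down, hence the reversed index. *)
  have -> : (i : nat) = (n - (rev_ord i).+1)%N by rewrite /= subnSK // subKn // ltnW.
  exact: (le_bigmax 0 (fun k : 'I_n => cmod F`_(n - k.+1)) (rev_ord i)).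
have sF : size F = n.+1 by rewrite prednK // size_poly_gt0 monic_neq0.
have Fn : F`_n = 1 by apply/eqP; rewrite -/(lead_coef F) -monicE.
have zn : z ^+ n = - \sum_(i < n) F`_i * z ^+ i.
  move: Fz; rewrite /root horner_coef sF big_ord_recr /= Fn mul1r.
  by rewrite addrC addr_eq0 => /eqP.
have rn : r ^+ n <= M * \sum_(i < n) r ^+ i.
  rewrite /r -cmodX zn /cmod normcN mulr_sumr; apply: le_trans (cmod_sum _ _ _ _) _.
  by apply: ler_sum => i _; rewrite cmodM cmodX ler_wpM2r ?exprn_ge0 ?cmod_ge0.
have S0 : 0 <= \sum_(i < n) r ^+ i.
  by apply: sumr_ge0 => i _; rewrite exprn_ge0 ?cmod_ge0.
have := subrX1 r n.
have : M * \sum_(i < n) r ^+ i <= (r - 1) * \sum_(i < n) r ^+ i.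
  by apply: ler_wpM2r => //; lra.
lra.
Qed.

End WindingNumber.

Theorem theorem1p7 (R : rcfType) (n : nat) (F : {poly R[i]})
  (F_monic : F \is monic) (F_degree : size F = n.+1)
  (x0 x1 y0 y1 : R) (x01 : x0 < x1) (y01 : y0 < y1)
  (disk_sub : forall z : R[i], cmod z < cauchy_radius F ->
                in_rect x0 x1 y0 y1 z) :
  winding_number (pp_comp F (rect_boundary x0 x1 y0 y1)) = n%:R.
Proof.
have [s Fs] := closed_field_poly_normal F.
have {}Fs : F = \prod_(z <- s) ('X - z%:P).
  by rewrite Fs (monicP F_monic) scale1r.
have ss : size s = n by move: F_degree; rewrite Fs size_prod_XsubC => -[].
suff si : all (rect_interior R x0 x1 y0 y1) s.
  by rewrite Fs -ss; have [_ ->] := winding_number_prod_XsubC R x0 x1 y0 y1 s si.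
apply/allP => z zs; have Fz : root F z by rewrite Fs root_prod_XsubC.
have zr := cauchy_radius_root R F z F_monic Fz.
(* The rectangle is closed, but [z] must be interior: the four points of modulus [m] on the axes lie
   in the disk, and [cmod z < m] makes the inequalities strict. *)
pose m := (cmod z + cauchy_radius F) / 2.
have zm : cmod z < m by rewrite /m; lra.
have mr : m < cauchy_radius F by rewrite /m; lra.
have m0 : 0 <= m by have := cmod_ge0 R z; lra.
have sqrtm : Num.sqrt (m ^+ 2) = m by rewrite sqrtr_sqr ger0_norm.
(* The squares treat [m] and [- m] at once. *)
have in_re (t : R) : t ^+ 2 = m ^+ 2 -> x0 <= t <= x1.
  move=> tm; have := disk_sub (Complex t 0).
  by rewrite /cmod /= expr0n addr0 tm sqrtm => /(_ mr)/andP[].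
have in_im (t : R) : t ^+ 2 = m ^+ 2 -> y0 <= t <= y1.
  move=> tm; have := disk_sub (Complex 0 t).
  by rewrite /cmod /= expr0n add0r tm sqrtm => /(_ mr)/andP[].
have /andP[_ mx1] := in_re m erefl; have /andP[x0m _] := in_re (- m) (sqrrN m).
have /andP[_ my1] := in_im m erefl; have /andP[y0m _] := in_im (- m) (sqrrN m).
have := ler_Re_cmod R z; have := ler_Im_cmod R z; rewrite !ler_norml.
by move=> /andP[? ?] /andP[? ?]; apply/andP; split; apply/andP; split; lra.
Qed.
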